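(* Let $R$ be an associative (not necessarily commutative) ring with $1\neq 0$ and let $M$ be a non-zero left $R$-module. (1) The pair $(\mathrm{Spec}^{\mathrm{s}}(M),\tau_c^{\mathrm{s}}(M))$ is a topological space, i.e. $\tau_c^{\mathrm{s}}(M)$ is a topology (a collection of open sets) on $\mathrm{Spec}^{\mathrm{s}}(M)$. (2) If every second submodule of $M$ is strongly hollow in $M$, then $M$ is a top$^{\mathrm{s}}$-module.
   Context: Ideals are two-sided. A non-zero left $R$-module $N$ is coprime if for every two-sided ideal $I$ of $R$ either $IN=N$ or $IN=0$. A second submodule of $M$ is a submodule $0\neq K\le M$ such that $K$ is a coprime $R$-module; $\mathrm{Spec}^{\mathrm{s}}(M)$ is the set of second submodules of $M$. For $L\le M$ put $\mathcal{V}^{\mathrm{s}}(L)=\{K\in\mathrm{Spec}^{\mathrm{s}}(M)\mid K\subseteq L\}$ and $\mathcal{X}^{\mathrm{s}}(L)=\{K\in\mathrm{Spec}^{\mathrm{s}}(M)\mid K\nsubseteq L\}$. For $L\le M$, $(0:_RL)=\{r\in R\mid rL=0\}$, and for an ideal $I$, $(0:_MI)=\{m\in M\mid Im=0\}$. Let $\mathcal{L}_c(M)=\{L\le M\mid L=(0:_M(0:_RL))\}$ and $\tau_c^{\mathrm{s}}(M)=\{\mathcal{X}^{\mathrm{s}}(L)\mid L\in\mathcal{L}_c(M)\}$. $M$ is a top$^{\mathrm{s}}$-module if $\xi^{\mathrm{s}}(M)=\{\mathcal{V}^{\mathrm{s}}(L)\mid L\le M\}$ is closed under finite unions, equivalently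 $\tau^{\mathrm{s}}(M)=\{\mathcal{X}^{\mathrm{s}}(L)\mid L\le M\}$ is a topology on $\mathrm{Spec}^{\mathrm{s}}(M)$. A submodule $0\neq L\le M$ is strongly hollow in $M$ if for all $L_1,L_2\le M$: $L\subseteq L_1+L_2$ implies $L\subseteq L_1$ or $L\subseteq L_2$. *)

(* Defs.v *)
From HB Require Import structures.
From mathcomp Require Import all_boot all_order all_algebra.
From mathcomp Require Import boolp classical_sets.

Set Implicit Arguments.
Unset Strict Implicit.
Unset Printing Implicit Defensive.

Import GRing.Theory.

Local Open Scope classical_set_scope.
Local Open Scope ring_scope.

(* The predicates in [submodClosed M] are boolean; as every proposition is
   classically decidable (boolp), they are all the submodules of M. *)

Section Submodules.
Variables (R : nzRingType) (M : lmodType R) (K : submodClosed M).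

Record submod_sub := SubmodSub { submod_val : M; _ : submod_val \in K }.

HB.instance Definition _ := [isSub for submod_val].
HB.instance Definition _ := [Choice of submod_sub by <:].
HB.instance Definition _ := [SubChoice_isSubLmodule of submod_sub by <:].

End Submodules.

(* Two-sided and possibly improper, unlike MathComp's [idealr]: a left ideal is
   a submodule of the regular left module R^o. *)
Record ideal (R : nzRingType) := Ideal {
  left_ideal :> submodClosed R^o;
  _ : forall a r : R, a \in left_ideal -> a * r \in left_ideal }.

Definition ideal_mul (R : nzRingType) (I : ideal R) (N : lmodType R) : set N :=
  [set x | exists s : seq (R * N),
     (forall p, p \in s -> p.1 \in left_ideal I) /\
     x = \sum_(p <- s) p.1 *: p.2].
Arguments ideal_mul {R} I N.

Definition nonzero_module (R : nzRingType) (N : lmodType R) : Prop :=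
  exists x : N, x != 0.

Definition coprime_module (R : nzRingType) (N : lmodType R) : Prop :=
  nonzero_module N /\
  forall I : ideal R, ideal_mul I N = setT \/ ideal_mul I N = [set 0].

Definition second (R : nzRingType) (M : lmodType R) (K : submodClosed M) :
    Prop :=
  coprime_module (submod_sub K : lmodType R).

Definition Spec_s (R : nzRingType) (M : lmodType R) :=
  {K : submodClosed M | second K}.

Definition V_s (R : nzRingType) (M : lmodType R) (L : submodClosed M) :
    set (Spec_s M) :=
  [set K : Spec_s M | {subset sval K <= L}].

Definition X_s (R : nzRingType) (M : lmodType R) (L : submodClosed M) :
    set (Spec_s M) :=
  [set K : Spec_s M | ~ {subset sval K <= L}].

Definition ann_ring (R : nzRingType) (M : lmodType R) (L : set M) : set R :=
  [set r | forall x, L x -> r *: x = 0].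

Definition ann_module (R : nzRingType) (M : lmodType R) (I : set R) : set M :=
  [set x | forall r, I r -> r *: x = 0].
Arguments ann_module {R} M I.

Definition L_c (R : nzRingType) (M : lmodType R) : set (submodClosed M) :=
  [set L : submodClosed M | [set` L] = ann_module M (ann_ring [set` L])].
Arguments L_c {R} M.

Definition tau_c (R : nzRingType) (M : lmodType R) : set (set (Spec_s M)) :=
  [set X_s L | L in L_c M].
Arguments tau_c {R} M.

Definition xi_s (R : nzRingType) (M : lmodType R) : set (set (Spec_s M)) :=
  range (@V_s R M).
Arguments xi_s {R} M.

Record is_topology (T : Type) (O : set (set T)) : Prop := IsTopology {
  topology_set0 : O set0;
  topology_setT : O setT;
  topology_setI : setI_closed O;
  topology_bigcup : forall (I : Type) (f : I -> set T),
    (forall i, O (f i)) -> O (\bigcup_i f i) }.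

(* [xi_s M set0] is the empty union. *)
Definition top_s_module (R : nzRingType) (M : lmodType R) : Prop :=
  xi_s M set0 /\ setU_closed (xi_s M).

Definition strongly_hollow (R : nzRingType) (M : lmodType R)
    (L : submodClosed M) : Prop :=
  (exists2 x, x \in L & x != 0) /\
  forall L1 L2 : submodClosed M,
    [set` L] `<=` [set x + y | x in [set` L1] & y in [set` L2]] ->
    {subset L <= L1} \/ {subset L <= L2}.

(* Main.v *)
Require Import Defs.
From HB Require Import structures.
From mathcomp Require Import all_boot all_order all_algebra.
From mathcomp Require Import boolp classical_sets.

(** The members of [tau_c M] are the complements of the sets of second
    submodules annihilated by a given ideal [I] of [R].  If a second submodule
    [K] is annihilated by the intersection of [I] and [J], then [J K] is either
    zero, so that [J] annihilates [K], or [K], so that [I K = I J K] is zero.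
    Hence finite unions of closed sets correspond to intersections of ideals,
    and intersections of closed sets to unions.  For strongly hollow second
    submodules, [V_s L1] and [V_s L2] have union [V_s (L1 + L2)]. *)

Import GRing.Theory.
Local Open Scope classical_set_scope.
Local Open Scope ring_scope.

(** Classical decidability turns the [Prop]-valued set [A] into the boolean predicate that
    [submodClosed] requires. *)
Lemma submodClosed_set (R : nzRingType) (M : lmodType R) (A : set M) :
  A 0 -> (forall a x y, A x -> A y -> A (a *: x + y)) ->
  exists L : submodClosed M, [set` L] = A.
Proof.
move=> A0 Alin.
pose inA : {pred M} := fun x => `[< A x >].
have SA : GRing.submod_closed inA.
  split=> [|a x y]; first by rewrite unfold_in; exact: asboolT.
  rewrite !unfold_in => /asboolP Ax /asboolP Ay; exact/asboolT/Alin.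
pose mixA := GRing.isSubmodClosed.Build R M inA SA.
pose L : submodClosed M := HB.pack inA mixA.
by exists L; apply/seteqP; split=> x /asboolP.
Qed.

(** Stability under right multiplication comes from [L] being a submodule:
    [(a * r) *: x = a *: (r *: x)] with [r *: x] again in [L]. *)
Lemma ann_ring_ideal (R : nzRingType) (M : lmodType R) (L : submodClosed M) :
  exists I : ideal R, [set` left_ideal I] = ann_ring [set` L].
Proof.
have [||I IE] := @submodClosed_set R R^o (ann_ring [set` L]).
- by move=> x _; rewrite scale0r.
- move=> a r s /= Lr Ls x Lx.
  by rewrite scalerDl -scalerA Lr // Ls // scaler0 addr0.
suff rI (a r : R) : a \in I -> a * r \in I by exists (Ideal rI).
have IP b : b \in I = ann_ring [set` L] b :> Prop by rewrite -IE.
by rewrite !IP => La x Lx; rewrite -scalerA La //= rpredZ.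
Qed.

Lemma ann_moduleK (R : nzRingType) (M : lmodType R) (S : set R) :
  ann_module M (ann_ring (ann_module M S)) = ann_module M S.
Proof.
apply/seteqP; split=> x Sx r Sr; last exact: Sr.
by apply: Sx => y; apply.
Qed.

(** [S] is an arbitrary set, so that a union of ideals can be used directly, without passing to the
    ideal it generates. *)
Definition X_ann (R : nzRingType) (M : lmodType R) (S : set R) :
    set (Spec_s M) :=
  [set K : Spec_s M | ~ [set` sval K] `<=` ann_module M S].
Arguments X_ann {R} M S.

(** Right multiplication makes the annihilator of [S] stable under scaling, as
    [r *: (a *: x) = (r * a) *: x]; by [ann_moduleK] this submodule lies in [L_c M]. *)
Lemma tau_c_ann (R : nzRingType) (M : lmodType R) (S : set R) :
  (forall a r, S a -> S (a * r)) ->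
  tau_c M (X_ann M S).
Proof.
move=> mulS; have [||L LE] := @submodClosed_set R M (ann_module M S).
- by move=> r _; rewrite scaler0.
- move=> a x y Sx Sy r Sr; rewrite scalerDr scalerA Sx ?Sy ?addr0 //.
  exact: mulS.
exists L; first by rewrite /L_c /= LE ann_moduleK.
by rewrite /X_ann -LE.
Qed.

Lemma tau_c_ideal (R : nzRingType) (M : lmodType R) (U : set (Spec_s M)) :
  tau_c M U ->
  exists I : ideal R, U = X_ann M [set` left_ideal I].
Proof.
move=> [L LL <-]; have [I IE] := ann_ring_ideal R M L.
by exists I; rewrite /X_ann IE -(LL : [set` L] = _).
Qed.

Lemma second_annI (R : nzRingType) (M : lmodType R) (K : submodClosed M)
    (I J : ideal R) :
  second K ->
  [set` K] `<=` ann_module M ([set` left_ideal I] `&` [set` left_ideal J]) ->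
  [set` K] `<=` ann_module M [set` left_ideal I] \/
  [set` K] `<=` ann_module M [set` left_ideal J].
Proof.
move=> [_ /(_ J) JK] IJK.
case: JK => JKE; [left|right] => x Kx r Ir.
  (* Case [J K = K]: write [x] as a sum of terms [p.1 *: p.2] with [p.1] in [J]. Each [r * p.1] lies
     in both ideals, hence kills [p.2]. *)
  have : ideal_mul J (submod_sub K : lmodType R) (SubmodSub Kx) by rewrite JKE.
  move=> [s [sJ /(congr1 \val)]]; rewrite raddf_sum [LHS]/= => ->.
  rewrite scaler_sumr big_seq big1 // => p ps.
  change (r *: (p.1 *: submod_val p.2) = 0); rewrite scalerA.
  apply: IJK; first exact: valP.
  split=> /=; first by case: (I) Ir => L mulI /= rL; exact: mulI.
  exact: (@rpredZ R R^o (left_ideal J) r p.1 (sJ p ps)).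
(* Case [J K = 0]: [r *: x] is a one-term element of [J K]. *)
have : ideal_mul J (submod_sub K : lmodType R) (r *: SubmodSub Kx).
  exists [:: (r, SubmodSub Kx)]; rewrite big_seq1; split=> // p.
  by rewrite inE => /eqP ->.
by rewrite JKE => /(congr1 (@submod_val R M K)).
Qed.

Lemma second_neq0 (R : nzRingType) (M : lmodType R) (K : submodClosed M) :
  second K -> ~ [set` K] `<=` [set 0].
Proof.
move=> [[x x0] _] K0; case/eqP: x0; apply: val_inj.
by rewrite raddf0; apply: K0; exact: valP.
Qed.

Lemma tau_c_topology (R : nzRingType) (M : lmodType R) : is_topology (tau_c M).
Proof.
split.
- have -> : set0 = X_ann M set0.
    by apply/seteqP; split=> K //= K0; apply: K0 => x _ r.
  exact: tau_c_ann.
- have -> : setT = X_ann M setT.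
    apply/seteqP; split=> K //= _ K0; apply: (second_neq0 _ _ _ (svalP K)) => x.
    (* Here [I] is the proof of [True]: the scalar 1 belongs to [setT], so only 0 is annihilated. *)
    by move=> /K0 /(_ 1 I); rewrite scale1r.
  exact: tau_c_ann.
- move=> U V /tau_c_ideal[I ->] /tau_c_ideal[J ->].
  have -> : X_ann M [set` left_ideal I] `&` X_ann M [set` left_ideal J] =
      X_ann M ([set` left_ideal I] `&` [set` left_ideal J]).
    apply/seteqP; split=> K /=.
      by move=> [KI KJ] /(second_annI _ _ _ _ _ (svalP K))[].
    by move=> KIJ; split=> KI; apply: KIJ => x /KI Ix r [Ir Jr]; exact: Ix.
  apply: tau_c_ann => a r /= [].
  by case: I => I mulI; case: J => J mulJ /= /mulI + /mulJ.
- move=> T f /(_ _)/tau_c_ideal-/choice[I fE].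
  have -> : \bigcup_i f i = X_ann M (\bigcup_i [set` left_ideal (I i)]).
    apply/seteqP; split=> K /=.
      move=> [i _]; rewrite fE /= => + KI; apply=> x /KI Ix r Ir.
      by apply: Ix; exists i.
    move=> KI; apply: contrapT => Kf; apply: KI => x Kx r [i _ Ir].
    have /contrapT KIi : ~ X_ann M [set` left_ideal (I i)] K.
      by move=> KIi; apply: Kf; exists i => //; rewrite fE.
    exact: KIi Ir.
  apply: tau_c_ann => a r [i _ Ia]; exists i => //=.
  by case: (I i) Ia => L mulL /mulL.
Qed.

Lemma strongly_hollow_top_s (R : nzRingType) (M : lmodType R) :
  (forall K : submodClosed M, second K -> strongly_hollow K) -> top_s_module M.
Proof.
move=> hollow; split.
  have [||L LE] := @submodClosed_set R M [set 0].
  - by [].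
  - by move=> a x y -> ->; rewrite scaler0 addr0.
  (* A second submodule is non-zero, so none lies in the zero submodule. *)
  exists L => //; apply/seteqP; split=> K //= KL.
  by apply: (second_neq0 _ _ _ (svalP K)); rewrite -LE.
move=> _ _ [L1 _ <-] [L2 _ <-].
have [||L LE] := @submodClosed_set R M
  [set x + y | x in [set` L1] & y in [set` L2]].
- by exists 0; rewrite /= ?rpred0 //; exists 0; rewrite /= ?rpred0 ?addr0.
- move=> a _ _ [x1 /= Lx1] [y1 /= Ly1] <- [x2 /= Lx2] [y2 /= Ly2] <-.
  exists (a *: x1 + x2); first by rewrite /= rpredD ?rpredZ.
  exists (a *: y1 + y2); first by rewrite /= rpredD ?rpredZ.
  by rewrite scalerDr addrACA.
have LP x : x \in L = [set x + y | x in [set` L1] & y in [set` L2]] x :> Prop.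
  by rewrite -LE.
exists L => //; apply/seteqP; split=> K /=.
  (* Only this inclusion uses strong hollowness; the other one adds 0 from the second summand. *)
  move=> KL; apply: (hollow _ (svalP K)).2.
  by rewrite -LE.
case=> KL x /KL Lx; rewrite LP.
  by exists x => //; exists 0; rewrite /= ?rpred0 ?addr0.
by exists 0; rewrite /= ?rpred0 //; exists x; rewrite ?add0r.
Qed.

Theorem theorem4p8 (R : nzRingType) (M : lmodType R) (hM : nonzero_module M) :
  is_topology (tau_c M) /\
  ((forall K : submodClosed M, second K -> strongly_hollow K) ->
   top_s_module M).
Proof.
split; first exact: tau_c_topology.
exact: strongly_hollow_top_s.
Qed.
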